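(* Let $X$ be a Banach space with separable dual $X^*$ and let $M=(M(t,A):t\ge 0,A\in\mathcal A)$ be a cylindrical orthogonal martingale-valued measure on $X^*$ with family of intensity measures $(\nu_{x^*}:x^*\in X^* )$. Assume that, whenever $x_n^*\to x^*$ in the unit sphere of $X^*$, for every $t>0$ we have $$\sup_{A\in\mathcal A}\ \sup_{0\le s\le t}\bigl|\nu_{x_n^*}((s,t]\times A)-\nu_{x^*}((s,t]\times A)\bigr|\ \longrightarrow\ 0\quad\text{in probability as } n\to\infty.$$ Then $(\nu_{x^*}:x^*\in X^* )$ satisfies the sequential boundedness property.
   Context: $(\Omega,\mathcal F,\mathbb P)$ is a complete probability space with a filtration $(\mathcal F_t)_{t\ge0}$ satisfying the usual conditions. $U$ is a Hausdorff topological space homeomorphic to a Borel subset of $\mathbb R$ (Lusin) and $\mathcal A$ is a ring of Borel subsets of $U$. For square integrable real martingales $Y,Z$, $\langle Y,Z\rangle$ is the predictable quadratic covariation (the unique predictable finite-variation process null at $0$ such that $YZ-\langle Y,Z\rangle$ is a martingale), and $\langle Y\rangle=\langle Y,Y\rangle$. A set function $N:\Omega\times\mathcal A\to\mathbb R$ is a $\sigma$-finite $L^2$-valued measure if: (1) $\mathbb E|N(A)|^2<\infty$ for all $A\in\mathcal A$; (2) $N(A\cup B)=N(A)+N(B)$ $\mathbb P$-a.e. for disjoint $A,B\in\mathcal A$; (3) there is a sequence $(U_n)$ in $\mathcal B(U)$ with $U_n\uparrow U$, $\mathcal B(U_n)\subseteq\mathcal A$ and $\sup_{A\in\mathcal B(U_n)}\mathbb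 E|N(A)|^2<\infty$ for each $n$; (4) for each $n$ and each sequence $(A_j)$ in $\mathcal B(U_n)$ decreasing to $\emptyset$, $\mathbb E|N(A_j)|^2\to0$; (5) for each $A\in\mathcal A$, $N(A)$ is the $L^2$-limit of $N(A\cap U_n)$. A cylindrical random variable on $X$ is a continuous linear map $X^*\to L^0(\Omega,\mathcal F,\mathbb P)$ (with convergence in probability). A cylindrical orthogonal martingale-valued measure on $X^*$ is a collection $M=(M(t,A):t\ge0,A\in\mathcal A)$ of cylindrical random variables on $X$ such that: (i) $M(0,A)(x^* )=0$ $\mathbb P$-a.e. for all $A,x^*$; (ii) for each $A$ and $x^*$, $M(A)(x^* )=(M(t,A)(x^* ))_{t\ge0}$ is a real càdlàg mean-zero square integrable martingale, and each $M(t,A):X^*\to L^0$ is continuous; (iii) for $t>0$ and $x^*\in X^*$, $M(t,\cdot)(x^* )$ is a $\sigma$-finite $L^2$-valued measure; (iv) $\langle M(A)(x^* ),M(B)(x^* )\rangle_t=0$ for $t>0$, $x^*\in X^*$ and disjoint $A,B\in\mathcal A$. A random measure on a measurable space $(S,\Sigma)$ is a map $\mu:\Omega\times\Sigma\to[0,\infty]$ such that $\mu(\cdot,E)$ is measurable for every $E\in\Sigma$ and $\mu(\omega,\cdot)$ is a measure for a.e. $\omega$. Such a random measure on $\mathcal B(\mathbb R_+)\otimes\mathcal B(U)$ is predictable if $(\omega,t)\mapsto\mu(\omega)([0,t]\times B)$ is predictable for each $B\in\mathcal B(U)$. The intensity measure $\nu_{x^*}$ is the unique predictable $\sigma$-finite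 random measure on $\mathcal B(\mathbb R_+)\otimes\mathcal B(U)$ with $\nu_{x^*}([0,t]\times A)=\langle M(A)(x^* )\rangle_t$ $\mathbb P$-a.e. for every $t\ge0$, $A\in\mathcal A$. The family $(\nu_{x^*})$ satisfies the sequential boundedness property if whenever $(x_n^* )$ is dense in the unit sphere of $X^*$, $\|x^*\|=1$ and $t>0$, there is $\Omega_{x^*}\subseteq\Omega$ with $\mathbb P(\Omega_{x^*})=1$ such that for all $0\le s<t$, $A\in\mathcal A$, $\omega\in\Omega_{x^*}$: $\nu_{x^*}(\omega)((s,t]\times A)\le\sup_{n\ge1}\nu_{x_n^*}(\omega)((s,t]\times A)$ (supremum of numbers in $[0,\infty]$). *)

(* Defs.v *)
From HB Require Import structures.
From mathcomp Require Import all_boot all_order all_algebra.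
From mathcomp Require Import all_classical all_reals all_analysis.
From mathcomp Require Import measurable_realfun.

Set Implicit Arguments.
Unset Strict Implicit.
Unset Printing Implicit Defensive.

Import Order.TTheory GRing.Theory Num.Theory.
Import numFieldNormedType.Exports.

Local Open Scope classical_set_scope.
Local Open Scope ring_scope.

Section dual.
Variables (R : realType) (X : normedModType R).

Definition dual_pred : {pred (X -> R^o)} :=
  [pred f | `[< linear f /\ continuous f >]].

Lemma dual_submod_closed : submod_closed dual_pred.
Proof.
split.
  apply/asboolP; split=> [a u v|]; last exact: cst_continuous.
  by rewrite scaler0 addr0.
move=> a f g /asboolP[lf cf] /asboolP[lg cg]; apply/asboolP; split.
  move=> b u v; have -> w : (a *: f + g) w = a *: f w + g w by [].
  rewrite -![(a *: f + g) _]/(a *: f _ + g _) lf lg !scalerDr !scalerA.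
  by rewrite (mulrC a b) addrACA.
by move=> x; apply: cvgD; [apply: cvgZl_tmp; exact: cf|exact: cg].
Qed.

HB.instance Definition _ :=
  GRing.isSubmodClosed.Build R (X -> R^o) dual_pred dual_submod_closed.

Record dual := Dual { dual_fun :> X -> R^o ; dualP : dual_fun \in dual_pred }.

HB.instance Definition _ := [isSub for dual_fun].
HB.instance Definition _ := [Choice of dual by <:].
HB.instance Definition _ := [SubChoice_isSubLmodule of dual by <:].

Definition dual_norm (f : dual) : R := sup [set `|f x| | x in [set x | `|x| <= 1]].

Lemma dual_bounded (f : dual) : exists M, forall x, `|f x| <= M * `|x|.
Proof.
have /asboolP[lf cf] := dualP f.
pose L := GRing.isLinear.Build R X R^o *:%R (dual_fun f) lf.
pose g : {linear X -> R^o} := HB.pack (dual_fun f) L.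
have : bounded_near g (nbhs 0) by apply/linear_bounded_continuous.
by move/linear_boundedP => /pinfty_ex_gt0[M M0 gM]; exists M.
Qed.

Lemma dualZ (f : dual) a x : f (a *: x) = a * f x.
Proof.
have /asboolP[lf _] := dualP f.
have f0 : f 0 = 0.
  have := lf 1 0 0; rewrite scaler0 addr0 scale1r => /eqP.
  by rewrite -subr_eq subrr => /eqP.
by have := lf a x 0; rewrite f0 !addr0.
Qed.

Lemma dual_norm_has_sup (f : dual) :
  has_sup [set `|f x| | x in [set x | `|x| <= 1]].
Proof.
split; first by exists `|f 0|, 0 => //=; rewrite normr0.
have [M fM] := dual_bounded f; exists `|M| => _ [x /= x1 <-].
rewrite (le_trans (fM x))// (le_trans (ler_norm _))// normrM normr_id.
by rewrite ler_piMr.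
Qed.

Lemma dual_norm_ub (f : dual) x : `|x| <= 1 -> `|f x| <= dual_norm f.
Proof.
by move=> x1; apply: sup_upper_bound; [exact: dual_norm_has_sup|exists x].
Qed.

Lemma dual_norm_le (f : dual) M :
  (forall x, `|x| <= 1 -> `|f x| <= M) -> dual_norm f <= M.
Proof.
move=> fM; apply: ge_sup; first by case: (dual_norm_has_sup f).
by move=> _ [x /= x1 <-]; exact: fM.
Qed.

Lemma dual_ler_normD f g : dual_norm (f + g) <= dual_norm f + dual_norm g.
Proof.
apply: dual_norm_le => x x1.
rewrite (_ : (f + g : dual) x = f x + g x) ?raddfD//.
by rewrite (le_trans (ler_normD _ _))// lerD// dual_norm_ub.
Qed.

Lemma dual_normrZ_le a f : dual_norm (a *: f) <= `|a| * dual_norm f.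
Proof.
apply: dual_norm_le => x x1.
have -> : (a *: f : dual) x = a * f x by [].
by rewrite normrM ler_wpM2l// dual_norm_ub.
Qed.

Lemma dual_normrZ a f : dual_norm (a *: f) = `|a| * dual_norm f.
Proof.
apply/eqP; rewrite eq_le dual_normrZ_le /=.
have [->|a0] := eqVneq a 0.
  rewrite normr0 mul0r (le_trans _ (dual_norm_ub (x := 0) _ _)) ?normr0//.
have := dual_normrZ_le a^-1 (a *: f).
rewrite scalerA mulVf// scale1r normfV.
by rewrite -ler_pdivrMl ?invr_gt0 ?normr_gt0// invrK.
Qed.

Lemma dual_normr0_eq0 f : dual_norm f = 0 -> f = 0.
Proof.
move=> f0; apply/val_inj/funext => x /=.
rewrite -[RHS]/(0 : R).
have [->|x0] := eqVneq x 0; first by rewrite -[0 in LHS](scale0r 0) dualZ mul0r.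
have : `|f (`|x|^-1 *: x)| <= 0.
  by rewrite -f0 dual_norm_ub// normrZ normfV normr_id mulVf ?normr_eq0.
by rewrite normr_le0 dualZ mulf_eq0 invr_eq0 normr_eq0 (negbTE x0)/= => /eqP.
Qed.

HB.instance Definition _ := Lmodule_isNormed.Build R dual
  dual_ler_normD dual_normrZ dual_normr0_eq0.

End dual.

Definition separable (T : topologicalType) :=
  exists2 D : set T, countable D & dense D.

(* Sigma-algebras are kept as set systems: those of a filtration live on one
   carrier, and U may be empty whereas measurableType is inhabited. *)

Section set_systems.
Context {R : realType}.

Definition borel (U : topologicalType) : set (set U) := <<s @open U >>.

Definition lusin (U : topologicalType) := exists B : set R, measurable B /\
  exists (f : U -> B) (g : B -> U),
    [/\ continuous f, continuous g, cancel f g & cancel g f].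

Definition measurable_wrt {d'} {T : Type} {T' : measurableType d'}
    (G : set (set T)) (f : T -> T') :=
  forall B, measurable B -> G (f @^-1` B).

Definition prod_salgebra {S T : Type} (G : set (set S)) (H : set (set T)) :
    set (set (S * T)) :=
  <<s [set A `*` B | A in G & B in H] >>.

Definition borelRplus : set (set {nonneg R}) :=
  [set (fun t : {nonneg R} => t%:num) @^-1` B | B in (measurable : set (set R))].

Definition is_measure {S : Type} (G : set (set S)) (mu : set S -> \bar R) :=
  [/\ mu set0 = 0%E,
      forall E, G E -> (0 <= mu E)%E &
      forall E : (set S)^nat, (forall i, G (E i)) -> trivIset setT E ->
        mu (\bigcup_i E i) = (\sum_(0 <= i <oo) mu (E i))%E].

Definition is_sigma_finite {S : Type} (G : set (set S)) (mu : set S -> \bar R) :=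
  exists2 E : (set S)^nat, \bigcup_i E i = setT &
    forall i, G (E i) /\ (mu (E i) < +oo)%E.

(* The distance on [0, +oo]; unlike `|a - b|, it is 0 at a = b = +oo. *)
Definition egap (a b : \bar R) : \bar R := if a == b then 0%E else `|a - b|%E.

End set_systems.

Section stochastics.
Context {R : realType} {d : measure_display} {Omega : measurableType d}.
Variable P : probability Omega R.
Implicit Types Y Z V : {nonneg R} -> Omega -> R.

(* mu_ext P is outer probability, and P on measurable sets: D i may fail to be
   measurable when it is an uncountable supremum. *)
Definition vanishes_in_probability {I : Type} (F : set_system I)
    (D : I -> Omega -> \bar R) :=
  forall e : R, 0 < e ->
    mu_ext P [set w | (e%:E < D i w)%E] @[i --> F] --> 0%E.

Definition second_moment (X : Omega -> R) : \bar R :=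
  ('E_P[(fun w => X w ^+ 2)%R])%E.

Definition usual_filtration (F : {nonneg R} -> set (set Omega)) :=
  [/\ forall t, sigma_algebra setT (F t) /\ F t `<=` measurable,
      forall s t, s <= t -> F s `<=` F t,
      forall t, F t = \bigcap_(s in [set s | t < s]) F s &
      P.-negligible `<=` F 0%:nng].

Variable F : {nonneg R} -> set (set Omega).

Definition adapted Y := forall t, measurable_wrt (F t) (Y t).

(* E[Y t | F s] = Y s, with conditional expectation characterised by integrals
   over the events of F s. *)
Definition martingale Y :=
  [/\ adapted Y,
      forall t, P.-integrable setT (EFin \o Y t) &
      forall s t A, s <= t -> F s A ->
        (\int[P]_(w in A) (Y t w)%:E = \int[P]_(w in A) (Y s w)%:E)%E].

(* Paths live on [0, +oo); x |-> f `|x| extends f evenly to the line, and agrees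
   with f on the one-sided neighbourhoods used here. *)
Definition cadlag_path (f : {nonneg R} -> R) :=
  (forall t, f `|x|%:nng @[x --> t%:num^'+] --> f t) /\
  (forall t : {nonneg R}, 0 < t%:num -> cvg (f `|x|%:nng @[x --> t%:num^'-])).

Definition cadlag Y := {ae P, forall w, cadlag_path (Y ^~ w)}.

Definition finite_variation Y := {ae P, forall w, forall t : {nonneg R},
  bounded_variation 0 t%:num (fun x => Y `|x|%:nng w)}.

Definition square_integrable Y := forall t, (second_moment (Y t) < +oo)%E.

Definition predictable_rect : set (set (Omega * {nonneg R})) :=
  [set G `*` [set 0%:nng] | G in F 0%:nng] `|`
  [set Q | exists s t G, F s G /\ Q = G `*` [set r | s < r <= t]].

Definition predictable {d'} {T : measurableType d'}
    (Y : {nonneg R} -> Omega -> T) :=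
  measurable_wrt <<s predictable_rect >> (fun z => Y z.2 z.1).

(* V is a version of <Y, Z>, which is unique up to indistinguishability; a finite
   variation process is understood to be cadlag. *)
Definition pred_covariation Y Z V :=
  [/\ predictable V, cadlag V, finite_variation V,
      {ae P, forall w, V 0%:nng w = 0} &
      martingale (fun t w => Y t w * Z t w - V t w)].

Definition random_measure {S : Type} (G : set (set S))
    (mu : Omega -> set S -> \bar R) :=
  [/\ forall w E, G E -> (0 <= mu w E)%E,
      forall E, G E -> measurable_fun setT (mu ^~ E) &
      {ae P, forall w, is_measure G (mu w)}].

Definition upto {U : Type} (t : {nonneg R}) (A : set U) : set ({nonneg R} * U) :=
  [set s | s <= t] `*` A.

Definition strip {U : Type} (s t : {nonneg R}) (A : set U) :
    set ({nonneg R} * U) :=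
  [set r | s < r <= t] `*` A.

Definition predictable_random_measure {U : topologicalType}
    (mu : Omega -> set ({nonneg R} * U) -> \bar R) :=
  forall B, borel B -> predictable (fun t w => mu w (upto t B)).

(* Random variables are represented by functions; N is only meaningful on AA. *)
Definition sigma_finite_L2_measure {U : topologicalType} (AA : set (set U))
    (N : set U -> Omega -> R) :=
  [/\ forall A, AA A -> measurable_fun setT (N A) /\
        (second_moment (N A) < +oo)%E,
      forall A B, AA A -> AA B -> A `&` B = set0 ->
        {ae P, forall w, N (A `|` B) w = N A w + N B w} &
      exists Un : (set U)^nat,
      [/\ (forall n, borel (Un n)) /\ (forall n, Un n `<=` Un n.+1) /\
            \bigcup_n Un n = setT,
          forall n A, borel A -> A `<=` Un n -> AA A,
          forall n, (ereal_sup [set second_moment (N A) |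
            A in [set A | borel A /\ A `<=` Un n]] < +oo)%E,
          forall n (A : (set U)^nat),
            (forall j, borel (A j) /\ A j `<=` Un n) ->
            (forall j, A j.+1 `<=` A j) -> \bigcap_j A j = set0 ->
            second_moment (N (A j)) @[j --> \oo] --> 0%E &
          forall A, AA A ->
            second_moment (fun w => N (A `&` Un n) w - N A w)
              @[n --> \oo] --> 0%E]].

(* A continuous linear map from the dual of X to L^0: linearity is modulo P-null
   sets, and the last clause is continuity for convergence in probability. *)
Definition cylindrical_rv {X : normedModType R} (Z : dual X -> Omega -> R) :=
  [/\ forall x, measurable_fun setT (Z x),
      forall (a : R) x y,
        {ae P, forall w, Z (a *: x + y) w = a * Z x w + Z y w} &
      forall x, vanishes_in_probability (nbhs x)
        (fun y w => `|Z y w - Z x w|%:E)].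

Definition cylindrical_orthogonal_mvm {X : normedModType R}
    {U : topologicalType} (AA : set (set U))
    (M : {nonneg R} -> set U -> dual X -> Omega -> R) :=
  [/\ forall t A, AA A -> cylindrical_rv (M t A),
      forall A x, AA A -> {ae P, forall w, M 0%:nng A x w = 0},
      forall A x, AA A ->
        let Y := fun t => M t A x in
        [/\ martingale Y, cadlag Y, square_integrable Y &
            forall t, ('E_P[Y t] = 0)%E],
      forall (t : {nonneg R}) x, 0 < t%:num ->
        sigma_finite_L2_measure AA (fun A => M t A x) &
      forall A B x, AA A -> AA B -> A `&` B = set0 ->
        exists2 V, pred_covariation (fun t => M t A x) (fun t => M t B x) V &
          forall t : {nonneg R}, 0 < t%:num -> {ae P, forall w, V t w = 0}].

Definition intensity_measure {X : normedModType R} {U : topologicalType}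
    (AA : set (set U)) (M : {nonneg R} -> set U -> dual X -> Omega -> R)
    (x : dual X) (nu : Omega -> set ({nonneg R} * U) -> \bar R) :=
  let G := prod_salgebra borelRplus (@borel U) in
  [/\ random_measure G nu,
      predictable_random_measure nu,
      {ae P, forall w, is_sigma_finite G (nu w)} &
      forall A, AA A ->
        exists2 V, pred_covariation (fun t => M t A x) (fun t => M t A x) V &
          forall t, {ae P, forall w, nu w (upto t A) = (V t w)%:E}].

Definition sequential_boundedness {X : normedModType R} {U : topologicalType}
    (AA : set (set U))
    (nu : dual X -> Omega -> set ({nonneg R} * U) -> \bar R) :=
  forall (x_ : (dual X)^nat) (x : dual X) (t : {nonneg R}),
    (forall n, `|x_ n| = 1) ->
    [set y : dual X | `|y| = 1] `<=` closure (range x_) ->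
    `|x| = 1 -> 0 < t%:num ->
    exists W : set Omega, [/\ measurable W, P W = 1%E &
      forall s A w, s < t -> AA A -> W w ->
        (nu x w (strip s t A) <=
          ereal_sup (range (fun n => nu (x_ n) w (strip s t A))))%E].

End stochastics.

(* Main.v *)
(* By density, x_(k_n) --> x for some k.  The gaps between nu_(x_(k_n)) and nu_x,
   uniform in A and s, tend to 0 in probability, so outside a null set they get
   below every e > 0 for some n; there nu_x(strip) <= nu_(x_(k_n))(strip) + e for
   all A and s simultaneously.  No almost surely convergent subsequence has to be
   extracted. *)
Require Import Defs.
From HB Require Import structures.
From mathcomp Require Import all_boot all_order all_algebra.
From mathcomp Require Import all_classical all_reals all_analysis.

Import Order.TTheory GRing.Theory Num.Theory.
Import numFieldNormedType.Exports.

Local Open Scope classical_set_scope.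
Local Open Scope ring_scope.

(** Off the diagonal, an infinite argument makes the gap [+oo], which no real [e] bounds, so only
    finite values call for arithmetic. On the diagonal the gap [0] still yields [0 <= e]. *)
Lemma le_egap (R : realType) (a b : \bar R) (e : R) :
  (egap a b <= e%:E)%E -> (b <= a + e%:E)%E.
Proof.
rewrite /egap; case: eqP => [->|_].
  by case: b => [b| |]//; rewrite -EFinD !lee_fin lerDl.
case: a b => [a| |] [b| |] //=; rewrite ?leNye ?leey//.
rewrite !lee_fin distrC => /(le_trans (ler_norm _)).
by rewrite lerBlDl.
Qed.

(** The union of a nearly optimal countable cover serves as [B], by countable subadditivity. *)
Lemma mu_ext_lt_cover (d : measure_display) (T : measurableType d)
    (R : realType) (mu : {measure set T -> \bar R}) (A : set T) (r : \bar R) :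
  (mu_ext mu A < r)%E ->
  exists B, [/\ measurable B, A `<=` B & (mu B < r)%E].
Proof.
move=> /ereal_inf_lt[_ [B [mB AB] <-] Br].
exists (\bigcup_k B k); split=> //; first exact: bigcup_measurable.
apply: le_lt_trans Br; apply: measure_sigma_subadditive => //.
exact: bigcup_measurable.
Qed.

(** Measurable covers of measure below [1/(k+1)] intersect in a measurable null set around [A],
    which may itself be non-measurable. *)
Lemma mu_ext_eq0_negligible (d : measure_display) (T : measurableType d)
    (R : realType) (mu : {measure set T -> \bar R}) (A : set T) :
  mu_ext mu A = 0%E -> mu.-negligible A.
Proof.
move=> A0.
have /choice[B HB] : forall k : nat, exists B,
    [/\ measurable B, A `<=` B & (mu B < (k.+1%:R^-1)%:E)%E].
  by move=> k; apply: mu_ext_lt_cover; rewrite A0 lte_fin invr_gt0.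
have mB k : measurable (B k) by case: (HB k).
exists (\bigcap_k B k); split.
- exact: bigcapT_measurable.
- apply/eqP; rewrite eq_le measure_ge0 andbT.
  apply/lee_addgt0Pr => e e0; rewrite add0e.
  have [k _ /(_ k (leqnn k)) ke] := near_infty_natSinv_lt (PosNum e0).
  apply: (@le_trans _ _ (mu (B k))).
    by apply: le_measure; rewrite ?inE//; [exact: bigcapT_measurable|exact: bigcap_inf].
  by case: (HB k) => _ _ /ltW/le_trans; apply; rewrite lee_fin ltW.
- by move=> w Aw k _; have [_ AB _] := HB k; exact: AB.
Qed.

(** The points where every [D i] exceeds a given tolerance lie in each single exceedance set, so
    their outer probability is at most the limit [0]. *)
Lemma vanishes_in_probability_ae (R : realType) (d : measure_display)
    (Omega : measurableType d) (P : probability Omega R) (I : Type)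
    (F : set_system I) (FF : ProperFilter F) (D : I -> Omega -> \bar R) :
  vanishes_in_probability P F D ->
  {ae P, forall w, forall e : R, 0 < e -> exists i, (D i w <= e%:E)%E}.
Proof.
move=> D0.
(* Countably many tolerances suffice and share one null set. *)
have : {ae P, forall w, forall m : nat, exists i, (D i w <= (m.+1%:R^-1)%:E)%E}.
  apply/ae_foralln => m; apply/mu_ext_eq0_negligible/eqP.
  rewrite eq_le mu_ext_ge0 ?andbT//.
  have /D0 : (0 : R) < m.+1%:R^-1 by rewrite invr_gt0.
  apply: cvge_ge; apply: nearW => i.
  by apply: le_mu_ext => w /= /forallNP/(_ i)/negP; rewrite -ltNge.
apply: filterS => w Dw e e0.
have [m _ /(_ m (leqnn m)) me] := near_infty_natSinv_lt (PosNum e0).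
have [i Di] := Dw m; exists i; apply: le_trans Di _.
by rewrite lee_fin ltW.
Qed.

(** The indices [k n] need not increase: terms may repeat, as they must when [l] is an isolated
    value of [u] taken only once. *)
Lemma closure_range_cvg (R : realType) (V : normedModType R) (u : nat -> V)
    (l : V) :
  closure (range u) l -> exists k : nat -> nat, u (k n) @[n --> \oo] --> l.
Proof.
move=> ul.
have /choice[k kl] : forall n : nat, exists k, `|l - u k| < n.+1%:R^-1.
  move=> n; have [|_ [[k _ <-] lk]] := ul (ball l n.+1%:R^-1).
    by apply: nbhsx_ballx; rewrite invr_gt0.
  by exists k; move: lk; rewrite -ball_normE.
exists k; apply/cvgrPdist_lt => e e0.
apply: filterS (near_infty_natSinv_lt (PosNum e0)) => n.
exact: lt_trans.
Qed.

Theorem proposition5p7 (R : realType)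
    (d : measure_display) (Omega : measurableType d) (P : probability Omega R)
    (P_complete : measure_is_complete P)
    (F : {nonneg R} -> set (set Omega)) (F_usual : usual_filtration P F)
    (U : topologicalType) (U_hausdorff : hausdorff_space U)
    (U_lusin : @lusin R U)
    (AA : set (set U)) (AA_ring : setring AA) (AA_borel : AA `<=` @borel U)
    (X : completeNormedModType R) (dual_separable : separable (dual X))
    (M : {nonneg R} -> set U -> dual X -> Omega -> R)
    (M_mvm : cylindrical_orthogonal_mvm P F AA M)
    (nu : dual X -> Omega -> set ({nonneg R} * U) -> \bar R)
    (nu_intensity : forall x, intensity_measure P F AA M x (nu x))
    (nu_continuous : forall (x_ : nat -> dual X) (x : dual X),
      (forall n, `|x_ n| = 1) -> `|x| = 1 -> x_ n @[n --> \oo] --> x ->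
      forall t : {nonneg R}, 0 < t%:num ->
      vanishes_in_probability P \oo (fun n w =>
        ereal_sup [set egap (nu (x_ n) w (strip s t A)) (nu x w (strip s t A)) |
          A in AA & s in [set s : {nonneg R} | s <= t]])) :
  sequential_boundedness P AA nu.
Proof.
move=> x_ x t x_1 x_dense x1 t0.
have [k kx] := closure_range_cvg _ _ _ _ (x_dense x x1).
have := nu_continuous _ x (fun n => x_1 (k n)) x1 kx t t0.
move=> /vanishes_in_probability_ae[N [mN N0 DN]].
(* [N] is a measurable null set containing the exceptional points, fixed before [s], [A] and [e]. *)
exists (~` N); split; first exact: measurableC.
  by rewrite probability_setC// N0 sube0.
move=> s A w st AAA /(subsetC DN); rewrite setCK => /= Dw.
(* The index [n] varies with [w] and [e]; the supremum over all indices absorbs this. *)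
apply/lee_addgt0Pr => e e0; have [n Dn] := Dw e e0.
apply: (@le_trans _ _ (nu (x_ (k n)) w (strip s t A) + e%:E)%E).
  apply: le_egap; apply: le_trans Dn; apply: ereal_sup_ubound.
  by exists A => //; exists s => //=; exact: ltW.
by rewrite leeD2r//; apply: ereal_sup_ubound; exists (k n).
Qed.
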